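(* Let $(M,\tau)$ be a tracial $W^\ast$-probability space, let $X_1,\dots,X_n\in M$ be self-adjoint, and assume that there are elements $\xi_1,\dots,\xi_n\in L^2(M,\tau)$ such that $(\xi_1,\dots,\xi_n)$ satisfies the conjugate relations for $(X_1,\dots,X_n)$, i.e. for all $j=1,\dots,n$ and all $P\in\mathbb{C}\langle Z_1,\dots,Z_n\rangle$, $$(\tau\otimes\tau)\big((\partial_jP)(X_1,\dots,X_n)\big)=\tau\big(\xi_j P(X_1,\dots,X_n)\big).$$ Then: (a) $X_1,\dots,X_n$ do not satisfy any non-trivial algebraic relation, i.e. there exists no non-zero polynomial $P\in\mathbb{C}\langle Z_1,\dots,Z_n\rangle$ such that $P(X_1,\dots,X_n)=0$. (b) For each $j=1,\dots,n$ there is a unique derivation $$\hat{\partial}_j:\ \mathbb{C}\langle X_1,\dots,X_n\rangle\to\mathbb{C}\langle X_1,\dots,X_n\rangle\otimes\mathbb{C}\langle X_1,\dots,X_n\rangle$$ which satisfies $\hat{\partial}_j(X_i)=\delta_{j,i}\,1\otimes 1$ for $i=1,\dots,n$.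
   Context: A tracial $W^\ast$-probability space $(M,\tau)$ is a von Neumann algebra $M$ with a faithful normal tracial state $\tau$. $L^2(M,\tau)$ is the Hilbert space completion of $M$ for $\langle a,b\rangle=\tau(ab^\ast)$; for $\xi\in L^2(M,\tau)$ and $a\in M$, $\tau(\xi a)$ means $\langle \xi,a^\ast\rangle$. $\mathbb{C}\langle Z_1,\dots,Z_n\rangle$ is the unital $\ast$-algebra of non-commutative polynomials in $n$ formal self-adjoint variables. $\partial_j:\mathbb{C}\langle Z_1,\dots,Z_n\rangle\to\mathbb{C}\langle Z_1,\dots,Z_n\rangle^{\otimes 2}$ (algebraic tensor product) is the unique derivation with $\partial_jZ_i=\delta_{i,j}1\otimes1$. For an algebra $A$, a derivation $\partial:A\to A\otimes A$ is a linear map with $\partial(P_1P_2)=(\partial P_1)(1\otimes P_2)+(P_1\otimes1)(\partial P_2)$ for all $P_1,P_2\in A$. Explicitly, on monomials $\partial_jP=\sum_{P=P_1Z_jP_2}P_1\otimes P_2$. For $X=(X_1,\dots,X_n)$, $\mathrm{ev}_X$ is the unital homomorphism $Z_i\mapsto X_i$ from $\mathbb{C}\langle Z_1,\dots,Z_n\rangle$ onto the unital subalgebra $\mathbb{C}\langle X_1,\dots,X_n\rangle\subset M$ generated by $X_1,\dots,X_n$. One writes $P(X)=\mathrm{ev}_X(P)$ for $P\in\mathbb{C}\langle Z_1,\dots,Z_n\rangle$ and $Q(X)=(\mathrm{ev}_X\otimes\mathrm{ev}_X)(Q)$ for $Q\in\mathbb{C}\langle Z_1,\dots,Z_n\rangle^{\otimes2}$.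 *)

(* Defs.v *)
From HB Require Import structures.
From mathcomp Require Import all_boot all_order all_algebra.
From mathcomp Require Import generic_quotient ring_quotient.
From mathcomp Require Import all_classical all_reals topology normedtype.
From mathcomp Require Import complex finmap.
From mathcomp Require Import -(notations) monalg.

Set Implicit Arguments.
Unset Strict Implicit.
Unset Printing Implicit Defensive.

Import GRing.Theory Num.Theory.
Import numFieldNormedType.Exports.

Local Open Scope ring_scope.
Local Open Scope quotient_scope.
Local Open Scope classical_set_scope.

Section TensorDef.
Context {K : comNzRingType} (A B : lmodType K).

(* The algebraic tensor product: the free K-module on the set A * B modulo the
   submodule spanned by the bilinearity relators; universal property: tliftE
   and tensor_linear_ext. *)
Definition pre_tensor := malg (A * B)%type K.
HB.instance Definition _ := GRing.Lmodule.on pre_tensor.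

Definition pre_tens (a : A) (b : B) : pre_tensor := mkmalgU (a, b) 1.

Definition bilinearity_relator (x : pre_tensor) : Prop :=
  (exists k a a' b,
     x = pre_tens (k *: a + a') b - (k *: pre_tens a b + pre_tens a' b)) \/
  (exists k a b b',
     x = pre_tens a (k *: b + b') - (k *: pre_tens a b + pre_tens a b')).

Definition tensor_rel : {pred pre_tensor} := fun x =>
  `[< forall S : {pred pre_tensor}, submod_closed S ->
        (forall r, bilinearity_relator r -> r \in S) -> x \in S >].

Lemma tensor_relP x : reflect (forall S : {pred pre_tensor}, submod_closed S ->
        (forall r, bilinearity_relator r -> r \in S) -> x \in S)
  (x \in tensor_rel).
Proof. by rewrite -[x \in _]/(asbool _); apply: asboolP. Qed.

Lemma tensor_rel_submod : submod_closed tensor_rel.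
Proof.
split=> [|k x y /tensor_relP Hx /tensor_relP Hy]; apply/tensor_relP => S S_sub SR.
  by case: S_sub.
by case: (S_sub) => _; apply; [apply: Hx | apply: Hy].
Qed.

HB.instance Definition _ :=
  GRing.isSubmodClosed.Build K pre_tensor tensor_rel tensor_rel_submod.

Definition tensor := {ideal_quot tensor_rel}.
HB.instance Definition _ := GRing.Zmodule.on tensor.

Definition topi (x : pre_tensor) : tensor := \pi_({ideal_quot tensor_rel}) x.

Lemma topiP x y : (topi x = topi y) <-> (x - y \in tensor_rel).
Proof.
by rewrite Quotient.idealrBE; split=> [/eqP | /eqP].
Qed.

Lemma topiD x y : topi (x + y) = topi x + topi y.
Proof. exact: raddfD. Qed.

Lemma topi_repr t : topi (repr t) = t.
Proof. exact: reprK. Qed.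

(* Unfolding the quotient makes failing unifications very slow, hence the
   locks: use topiZ, tens_def, tlift_pi, tmul_lift. *)
Fact tensor_key : unit. Proof. by []. Qed.

Definition tscale : K -> tensor -> tensor :=
  locked_with tensor_key (fun k t => topi (k *: repr t)).

Lemma topiZ k x : tscale k (topi x) = topi (k *: x).
Proof.
rewrite /tscale unlock; apply/topiP; rewrite -scalerBr; apply: rpredZ; apply/topiP.
exact: topi_repr.
Qed.

Lemma tensor_pi_ind (P : tensor -> Prop) : (forall x, P (topi x)) -> forall t, P t.
Proof. by move=> H t; rewrite -(topi_repr t). Qed.

Lemma tscaleA a b t : tscale a (tscale b t) = tscale (a * b) t.
Proof. by elim/tensor_pi_ind: t => x; rewrite !topiZ scalerA. Qed.
Lemma tscale1 : left_id 1 tscale.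
Proof. by elim/tensor_pi_ind=> x; rewrite topiZ scale1r. Qed.
Lemma tscaleDr : right_distributive tscale +%R.
Proof.
move=> k; elim/tensor_pi_ind=> x; elim/tensor_pi_ind=> y.
by rewrite -topiD !topiZ -topiD scalerDr.
Qed.
Lemma tscaleDl t : {morph tscale^~ t : a b / a + b}.
Proof.
by move=> a b; elim/tensor_pi_ind: t => x; rewrite !topiZ -topiD scalerDl.
Qed.

HB.instance Definition _ := GRing.Zmodule_isLmodule.Build K tensor
  tscaleA tscale1 tscaleDr tscaleDl.

Lemma topi_is_linear : linear topi.
Proof. by move=> k x y; rewrite topiD -topiZ. Qed.

HB.instance Definition _ :=
  GRing.isLinear.Build K pre_tensor tensor _ topi topi_is_linear.

Definition tens : A -> B -> tensor :=
  locked_with tensor_key (fun a b => topi (pre_tens a b)).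

Lemma tens_def a b : tens a b = topi (pre_tens a b).
Proof. by rewrite /tens unlock. Qed.

Lemma tens_is_bilinear : bilinear_for *:%R *:%R tens.
Proof.
split=> [b k a a' | a k b b']; rewrite !tens_def -linearP; apply/topiP;
  apply/tensor_relP => S _; apply.
  by left; exists k, a, a', b.
by right; exists k, a, b, b'.
Qed.

HB.instance Definition _ :=
  bilinear_isBilinear.Build K A B tensor *:%R *:%R tens tens_is_bilinear.

End TensorDef.

Notation "a \ox b" := (tens a b) (at level 40, left associativity) : ring_scope.

Section LinearExtension.
Context {K : comNzRingType} {T : choiceType} {W : lmodType K} (f : T -> W).

Definition linext (x : malg T K) : W := \sum_(k <- msupp x) mcoeff k x *: f k.

Lemma linextEw (d : {fset T}) x :
  (msupp x `<=` d)%fset -> linext x = \sum_(k <- d) mcoeff k x *: f k.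
Proof.
move=> le; rewrite /linext (big_fset_incl _ le) // => k _.
by move/mcoeff_outdom => ->; rewrite scale0r.
Qed.

Lemma linext_is_linear : linear linext.
Proof.
move=> k x y; pose d := (msupp x `|` msupp y `|` msupp (k *: x + y))%fset.
rewrite !(@linextEw d).
- rewrite scaler_sumr -big_split /=; apply: eq_bigr => i _.
  by rewrite mcoeffD mcoeffZ scalerDl scalerA.
- by rewrite /d -fsetUA (fsetUCA (msupp x)) fsubsetUl.
- by rewrite /d -fsetUA fsubsetUl.
- by rewrite /d fsubsetUr.
Qed.

HB.instance Definition _ :=
  GRing.isLinear.Build K (malg T K) W _ linext linext_is_linear.

Lemma linextE k : linext (mkmalgU k 1) = f k.
Proof.
rewrite (@linextEw [fset k]%fset) ?msuppU_le //.
by rewrite big_seq_fset1 mcoeffUU scale1r.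
Qed.

End LinearExtension.

Lemma malg_mcoeffE (K : comNzRingType) (T : choiceType) (x : malg T K) :
  x = \sum_(k <- msupp x) mcoeff k x *: mkmalgU k 1.
Proof.
rewrite {1}[x]monalgE; apply: eq_bigr => k _.
by apply/malgP => k'; rewrite mcoeffZ !mcoeffU mulr_natr.
Qed.

Section TensorLift.
Context {K : comNzRingType} {A B W : lmodType K}.

Definition pre_lift (f : A -> B -> W) : pre_tensor A B -> W :=
  linext (fun ab : A * B => f ab.1 ab.2).
HB.instance Definition _ f := GRing.Linear.on (pre_lift f).

Lemma pre_liftE f a b : pre_lift f (pre_tens a b) = f a b.
Proof. exact: linextE. Qed.

Context (f : {bilinear A -> B -> W}).

Lemma pre_lift0 x : x \in @tensor_rel K A B -> pre_lift f x = 0.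
Proof.
move/tensor_relP => /(_ [pred y | pre_lift f y == 0]) H; apply/eqP; apply: H.
  split=> [|k y z /eqP Hy /eqP Hz]; rewrite inE ?linear0 //.
  by rewrite linearP /= Hy Hz scaler0 addr0.
move=> r [[k [a [a' [b ->]]]] | [k [a [b [b' ->]]]]]; rewrite inE;
  rewrite linearB /= linearP /= !pre_liftE.
  by rewrite linearPl subrr.
by rewrite linearPr subrr.
Qed.

Definition tlift : tensor A B -> W :=
  locked_with tensor_key (fun t => pre_lift f (repr t)).

Lemma tlift_pi x : tlift (topi x) = pre_lift f x.
Proof.
apply/eqP; rewrite -subr_eq0 /tlift unlock -linearB; apply/eqP/pre_lift0/topiP.
exact: topi_repr.
Qed.

Lemma tlift_is_linear : linear tlift.
Proof.
move=> k t u; rewrite -(topi_repr t) -(topi_repr u).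
move: (repr t) (repr u) => x y.
by rewrite -linearP !tlift_pi linearP.
Qed.

HB.instance Definition _ :=
  GRing.isLinear.Build K (tensor A B) W _ tlift tlift_is_linear.

Lemma tliftE a b : tlift (a \ox b) = f a b.
Proof. by rewrite tens_def tlift_pi pre_liftE. Qed.

End TensorLift.

Section TensorInd.
Context {K : comNzRingType} {A B : lmodType K}.

Lemma tensor_ind (P : tensor A B -> Prop) :
  P 0 -> (forall k a b t, P t -> P (k *: (a \ox b) + t)) -> forall t, P t.
Proof.
move=> P0 PS t; rewrite -(topi_repr t) [repr t]malg_mcoeffE linear_sum /=.
elim/big_rec: _ => // -[a b] t' _ Pt'; rewrite linearZ /= -tens_def.
exact: PS.
Qed.

Lemma tensPl (b : B) k (a a' : A) :
  (k *: a + a') \ox b = k *: (a \ox b) + a' \ox b.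
Proof. exact: linearPl. Qed.

Lemma tensPr (a : A) k (b b' : B) :
  a \ox (k *: b + b') = k *: (a \ox b) + a \ox b'.
Proof. exact: linearPr. Qed.

Lemma tensor_linear_ext (W : lmodType K) (f g : {linear tensor A B -> W}) :
  (forall a b, f (a \ox b) = g (a \ox b)) -> f =1 g.
Proof.
move=> fg; elim/tensor_ind => [|k a b t IH]; first by rewrite !linear0.
by rewrite !linearP fg IH.
Qed.

End TensorInd.

Section TensorMap.
Context {K : comNzRingType} {A A' B B' : lmodType K}.
Context (f : {linear A -> A'}) (g : {linear B -> B'}).

Definition tmap_fun (a : A) (b : B) : tensor A' B' := f a \ox g b.

Lemma tmap_fun_is_bilinear : bilinear_for *:%R *:%R tmap_fun.
Proof.
split=> [b k a a' | a k b b']; rewrite /tmap_fun linearP.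
  by rewrite linearPl.
by rewrite linearPr.
Qed.

HB.instance Definition _ := bilinear_isBilinear.Build K A B (tensor A' B')
  *:%R *:%R tmap_fun tmap_fun_is_bilinear.

Definition tmap : tensor A B -> tensor A' B' := tlift tmap_fun.
HB.instance Definition _ := GRing.Linear.on tmap.

Lemma tmapE a b : tmap (a \ox b) = f a \ox g b.
Proof. exact: tliftE. Qed.

Lemma tmapP k t u : tmap (k *: t + u) = k *: tmap t + tmap u.
Proof. exact: linearP. Qed.

Lemma tmap0 : tmap 0 = 0.
Proof. exact: linear0. Qed.

End TensorMap.

Section TensorForm.
Context {K : comNzRingType} {A B : lmodType K} (f : {scalar A}) (g : {scalar B}).

Definition tform_fun (a : A) (b : B) : K^o := f a * g b.

Lemma tform_fun_is_bilinear : bilinear_for *:%R *:%R tform_fun.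
Proof.
split=> [b k a a' | a k b b']; rewrite /tform_fun linearP.
  by rewrite mulrDl -mulrA.
by rewrite mulrDr mulrCA.
Qed.

HB.instance Definition _ := bilinear_isBilinear.Build K A B K^o
  *:%R *:%R tform_fun tform_fun_is_bilinear.

Definition tform (t : tensor A B) : K := tlift tform_fun t.

Lemma tform_is_scalar : scalar tform.
Proof. by move=> k t u; rewrite /tform linearP. Qed.

HB.instance Definition _ :=
  GRing.isLinear.Build K (tensor A B) K _ tform tform_is_scalar.

Lemma tformE a b : tform (a \ox b) = f a * g b.
Proof. by rewrite /tform tliftE. Qed.

End TensorForm.

Section TensorAlgebra.
Let lmodACA (K : comNzRingType) (V : lmodType K) (c k : K) (p q r s : V) :
  c *: (k *: p + q) + (k *: r + s) = k *: (c *: p + r) + (c *: q + s).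
Proof. by rewrite !scalerDr !scalerA [c * k]mulrC addrACA. Qed.

Context {K : comNzRingType} (A B : algType K).

Definition tmull (u : tensor A B) (a : A) (b : B) : tensor A B :=
  tmap (a \*o idfun) (b \*o idfun) u.

Lemma tmull_linearl u b k a a' :
  tmull u (k *: a + a') b = k *: tmull u a b + tmull u a' b.
Proof.
rewrite /tmull; elim/(@tensor_ind K A B): u => [|c x y t IH].
  by rewrite !tmap0 scaler0 addr0.
rewrite !tmapP /= IH !tmapE /= mulrDl -scalerAl tensPl.
exact: lmodACA.
Qed.

Lemma tmull_linearr u a k b b' :
  tmull u a (k *: b + b') = k *: tmull u a b + tmull u a b'.
Proof.
rewrite /tmull; elim/(@tensor_ind K A B): u => [|c x y t IH].
  by rewrite !tmap0 scaler0 addr0.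
rewrite !tmapP /= IH !tmapE /= mulrDl -scalerAl tensPr.
exact: lmodACA.
Qed.

Lemma tmull_is_bilinear u : bilinear_for *:%R *:%R (tmull u).
Proof.
by split=> [b k a a' | a k b b']; [apply: tmull_linearl | apply: tmull_linearr].
Qed.

HB.instance Definition _ u := bilinear_isBilinear.Build K A B (tensor A B)
  *:%R *:%R (tmull u) (tmull_is_bilinear u).

(* The product determined by (a \ox b) * (c \ox d) = (a * c) \ox (b * d) *)
Definition tmul : tensor A B -> tensor A B -> tensor A B :=
  locked_with tensor_key (fun t u => tlift (tmull u) t).

Lemma tmul_lift t u : tmul t u = tlift (tmull u) t.
Proof. by rewrite /tmul unlock. Qed.

Lemma tmul_pure a b u : tmul (a \ox b) u = tmull u a b.
Proof. by rewrite tmul_lift tliftE. Qed.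

Lemma tmulE a b c d : tmul (a \ox b) (c \ox d) = (a * c) \ox (b * d).
Proof. by rewrite tmul_pure /tmull tmapE. Qed.

Lemma tmul0l u : tmul 0 u = 0. Proof. by rewrite tmul_lift linear0. Qed.

Lemma tmulPl k t t' u : tmul (k *: t + t') u = k *: tmul t u + tmul t' u.
Proof. by rewrite !tmul_lift linearP. Qed.

Lemma tmulPr t k u u' : tmul t (k *: u + u') = k *: tmul t u + tmul t u'.
Proof.
elim/(@tensor_ind K A B): t => [|c x y t IH].
  by rewrite !tmul0l scaler0 addr0.
rewrite !tmulPl IH !tmul_pure /tmull tmapP; exact: lmodACA.
Qed.

Lemma tmul0r t : tmul t 0 = 0.
Proof. by have := tmulPr t (-1) 0 0; rewrite scaler0 addr0 scaleN1r addNr. Qed.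

Lemma tmulA : associative tmul.
Proof.
move=> t u v.
elim/(@tensor_ind K A B): t => [|k a b t IHt]; first by rewrite !tmul0l.
rewrite !tmulPl -IHt; congr (k *: _ + _); clear t IHt.
elim/(@tensor_ind K A B): u => [|k' c d u IHu]; first by rewrite !(tmul0l, tmul0r).
rewrite !(tmulPl, tmulPr) IHu; congr (k' *: _ + _); clear u IHu.
elim/(@tensor_ind K A B): v => [|k'' e f v IHv]; first by rewrite !tmul0r.
by rewrite !tmulPr IHv !tmulE !mulrA.
Qed.

Lemma tmul1l : left_id (1 \ox 1) tmul.
Proof.
elim/(@tensor_ind K A B) => [|k a b t IH]; first by rewrite tmul0r.
by rewrite tmulPr IH tmulE !mul1r.
Qed.

Lemma tmul1r : right_id (1 \ox 1) tmul.
Proof.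
elim/(@tensor_ind K A B) => [|k a b t IH]; first by rewrite tmul0l.
by rewrite tmulPl IH tmulE !mulr1.
Qed.

Lemma tmulDl : left_distributive tmul +%R.
Proof. by move=> x y z; have := tmulPl 1 x y z; rewrite !scale1r. Qed.

Lemma tmulDr : right_distributive tmul +%R.
Proof. by move=> x y z; have := tmulPr x 1 y z; rewrite !scale1r. Qed.

HB.instance Definition _ := GRing.Zmodule_isPzRing.Build (tensor A B)
  tmulA tmul1l tmul1r tmulDl tmulDr.

Lemma tensM (a c : A) (b d : B) : (a \ox b) * (c \ox d) = (a * c) \ox (b * d).
Proof. exact: tmulE. Qed.

Lemma tensor_scaleAl k (x y : tensor A B) : k *: (x * y) = (k *: x) * y.
Proof. by have := tmulPl k x 0 y; rewrite tmul0l !addr0. Qed.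

Lemma tensor_scaleAr k (x y : tensor A B) : k *: (x * y) = x * (k *: y).
Proof. by have := tmulPr x k y 0; rewrite tmul0r !addr0. Qed.

End TensorAlgebra.

Definition is_derivation (K : comNzRingType) (A : algType K)
    (d : A -> tensor A A) : Prop :=
  linear d /\
  forall p q : A, d (p * q) = d p * (1 \ox q) + (p \ox 1) * d q.

Section NCPoly.
Context (K : comNzRingType) (n : nat).

(* K<Z_1, ..., Z_n>: fmonom 'I_n is the free monoid on n letters *)
Definition ncpoly := malg (fmonom 'I_n) K.
HB.instance Definition _ := GRing.Lalgebra.on ncpoly.

Definition ncmon (w : seq 'I_n) : ncpoly := mkmalgU (FMonom w) 1.
Definition ncvar (i : 'I_n) : ncpoly := ncmon [:: i].

Lemma ncpoly_ind (P : ncpoly -> Prop) :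
  P 0 -> (forall k w p, P p -> P (k *: ncmon w + p)) -> forall p, P p.
Proof.
move=> P0 PS p; rewrite [p]malg_mcoeffE.
by elim/big_rec: _ => // -[w] q _ Pq; apply: PS.
Qed.

Lemma ncmon1 : ncmon [::] = 1.
Proof.
rewrite /ncmon; congr mkmalgU.
by apply: val_inj; rewrite /= fm1.
Qed.

Lemma ncmonM u v : ncmon u * ncmon v = ncmon (u ++ v).
Proof.
rewrite /ncmon malgM_def fgmulUU [_ * _]mulr1; congr mkmalgU.
by apply: val_inj; rewrite /= fmM.
Qed.

Lemma ncpoly_scaleAr k (p q : ncpoly) : k *: (p * q) = p * (k *: q).
Proof.
have kp : p * mkmalgU mone k = mkmalgU mone k * p :> ncpoly.
  rewrite !malgM_def fgmulUg fgmulgU; apply: eq_bigr => w _.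
  by rewrite mulm1 mul1m [_ * k]mulrC.
rewrite -[LHS]mul_malgC -[k *: q]mul_malgC [LHS]mulrA [RHS]mulrA.
exact: (congr1 (fun x : ncpoly => x * q) (esym kp)).
Qed.

HB.instance Definition _ := GRing.Lalgebra_isAlgebra.Build K ncpoly
  ncpoly_scaleAr.

End NCPoly.

Section NCEval.
Context (K : comNzRingType) (n : nat) (A : algType K) (X : 'I_n -> A).

Definition nceval_word (w : fmonom 'I_n) : A := \prod_(i <- (w : seq 'I_n)) X i.

Lemma nceval_word_mmorphism : mmorphism nceval_word.
Proof.
by split=> [u v|]; rewrite /nceval_word ?fmM ?big_cat ?fm1 ?big_nil.
Qed.

HB.instance Definition _ :=
  monalg.isMultiplicative.Build (fmonom 'I_n) A nceval_word
    nceval_word_mmorphism.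

Definition nceval (p : ncpoly K n) : A := mmap (GRing.in_alg A) nceval_word p.

Lemma nceval_is_linear : linear nceval.
Proof. by move=> k p q; rewrite /nceval raddfD /= mmapZ /= mulr_algl. Qed.

HB.instance Definition _ :=
  GRing.isLinear.Build K (ncpoly K n) A _ nceval nceval_is_linear.

Lemma nceval_is_monoid_morphism : monoid_morphism nceval.
Proof.
have [|HM H1] :=
  @commr_mmap_is_multiplicative (fmonom 'I_n) K A (GRing.in_alg A) nceval_word.
  by move=> g m m'; rewrite /GRing.comm /= mulr_algl mulr_algr.
by split; [apply: H1 | apply: HM].
Qed.

HB.instance Definition _ :=
  GRing.isMonoidMorphism.Build (ncpoly K n) A nceval nceval_is_monoid_morphism.

Lemma nceval_mon w : nceval (ncmon K w) = \prod_(i <- w) X i.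
Proof. by rewrite /nceval mmapU /= scale1r mul1r. Qed.

Lemma nceval_var i : nceval (ncvar K i) = X i.
Proof. by rewrite nceval_mon big_seq1. Qed.

End NCEval.

Section Leibniz.
Context (K : comNzRingType) (A : algType K) (d : A -> tensor A A).
Hypothesis d_lin : linear d.

Let leibniz p q := d (p * q) = d p * (1 \ox q) + (p \ox 1) * d q.

Let d0 : d 0 = 0.
Proof. by have := d_lin (-1) 0 0; rewrite scaler0 addr0 scaleN1r addNr. Qed.

Lemma leibniz0l q : leibniz 0 q.
Proof. by rewrite /leibniz mul0r d0 mul0r linear0l mul0r addr0. Qed.

Lemma leibniz0r p : leibniz p 0.
Proof. by rewrite /leibniz mulr0 d0 mulr0 linear0r mulr0 addr0. Qed.

Lemma leibnizPl c u p q : leibniz u q -> leibniz p q -> leibniz (c *: u + p) q.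
Proof.
rewrite /leibniz mulrDl -scalerAl !d_lin => -> ->.
rewrite tensPl [in RHS]mulrDl [in RHS]mulrDl.
by rewrite -!tensor_scaleAl [RHS]addrACA -scalerDr.
Qed.

Lemma leibnizPr c p v q : leibniz p v -> leibniz p q -> leibniz p (c *: v + q).
Proof.
rewrite /leibniz mulrDr -scalerAr !d_lin => -> ->.
rewrite tensPr [in RHS]mulrDr [in RHS]mulrDr.
by rewrite -!tensor_scaleAr [RHS]addrACA -scalerDr.
Qed.

Lemma derivation1 : leibniz 1 1 -> d 1 = 0.
Proof.
have -> : leibniz 1 1 = (d 1 = d 1 + d 1) by rewrite /leibniz !(mulr1, mul1r).
by move=> /eqP; rewrite -subr_eq0 opprD addrA subrr add0r oppr_eq0 => /eqP.
Qed.

End Leibniz.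

Section FreeDifferenceQuotient.
Context (K : comNzRingType) (n : nat) (j : 'I_n).
Local Notation "'C<Z>'" := (ncpoly K n).

(* d_j w is the sum of the w1 (x) w2 over the factorizations w = w1 Z_j w2;
   fdq_unique: fdq is the only derivation with d_j Z_i = delta_ij 1 (x) 1. *)
Definition fdq_word (w : seq 'I_n) : tensor C<Z> C<Z> :=
  \sum_(k < size w | onth w k == Some j)
    ncmon K (take k w) \ox ncmon K (drop k.+1 w).

Definition fdq : C<Z> -> tensor C<Z> C<Z> :=
  linext (fun w : fmonom 'I_n => fdq_word w).
HB.instance Definition _ := GRing.Linear.on fdq.

Lemma fdq_mon w : fdq (ncmon K w) = fdq_word w.
Proof. exact: linextE. Qed.

Lemma fdq_word_cat u v : fdq_word (u ++ v) =
  fdq_word u * (1 \ox ncmon K v) + (ncmon K u \ox 1) * fdq_word v.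
Proof.
rewrite /fdq_word mulr_suml mulr_sumr.
rewrite -(big_mkord (fun k => onth (u ++ v) k == Some j)
  (fun k => ncmon K (take k (u ++ v)) \ox ncmon K (drop k.+1 (u ++ v)))).
rewrite size_cat (big_cat_nat _ (n := size u)) ?leq_addr //=; congr (_ + _).
  rewrite big_mkord; apply: eq_big => [k | k _].
    by rewrite onth_cat ltn_ord.
  rewrite tensM mulr1 ncmonM take_cat ltn_ord drop_cat.
  have := ltn_ord k; rewrite leq_eqVlt => /orP[/eqP e | ->] //.
  by rewrite e ltnn subnn drop0 drop_oversize ?e.
rewrite -{1}[size u]add0n big_addn addKn big_mkord.
apply: eq_big => [k | k _].
  by rewrite onth_cat ltnNge leq_addl /= addnK.
rewrite tensM mul1r ncmonM take_cat drop_cat ltnNge leq_addl /= addnK.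
by rewrite ltnNge -addSn leq_addl /= addnK.
Qed.

Lemma fdqP k p q : fdq (k *: p + q) = k *: fdq p + fdq q.
Proof. exact: linext_is_linear. Qed.

Lemma fdqM p q : fdq (p * q) = fdq p * (1 \ox q) + (p \ox 1) * fdq q.
Proof.
elim/ncpoly_ind: p => [|c u p IHp]; first exact: (leibniz0l fdqP).
apply: (leibnizPl fdqP) IHp; clear p c.
elim/ncpoly_ind: q => [|d v q IHq]; first exact: (leibniz0r fdqP).
apply: (leibnizPr fdqP) IHq; clear q d.
by rewrite ncmonM !fdq_mon fdq_word_cat.
Qed.

Lemma fdq_is_derivation : is_derivation fdq.
Proof. by split; [exact: linext_is_linear | exact: fdqM]. Qed.

Lemma fdq_var i : fdq (ncvar K i) = (j == i)%:R *: (1 \ox 1).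
Proof.
rewrite fdq_mon /fdq_word big_mkcond big_ord1 /= ncmon1 eq_sym.
by rewrite (inj_eq (@Some_inj _)); case: eqP; rewrite ?scale1r ?scale0r.
Qed.

Lemma fdq_unique (d : C<Z> -> tensor C<Z> C<Z>) : is_derivation d ->
  (forall i, d (ncvar K i) = (j == i)%:R *: (1 \ox 1)) -> d =1 fdq.
Proof.
move=> [dL dM] dX.
have d0 : d 0 = 0.
  by have := dL (-1) 0 0; rewrite scaler0 addr0 scaleN1r addNr.
have fdq0 : fdq 0 = 0 by exact: linear0.
have d1 : d 1 = fdq 1.
  exact: etrans (derivation1 (dM 1 1)) (esym (derivation1 (fdqM 1 1))).
elim/ncpoly_ind=> [|k w p IHp]; first by rewrite d0 fdq0.
rewrite dL fdqP IHp; congr (k *: _ + _); clear p IHp.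
elim: w => [|i w IHw]; first by rewrite ncmon1.
by rewrite -cat1s -ncmonM dM fdqM IHw dX fdq_var.
Qed.

End FreeDifferenceQuotient.

Section GeneratedSubalgebra.
Context (K : comNzRingType) (n : nat) (A : algType K) (X : 'I_n -> A).

Definition gen_subalg_pred : {pred A} := fun a =>
  `[< forall S : {pred A}, subalg_closed S -> (forall i, X i \in S) -> a \in S >].

Lemma gen_subalgP a : reflect
  (forall S : {pred A}, subalg_closed S -> (forall i, X i \in S) -> a \in S)
  (a \in gen_subalg_pred).
Proof. by rewrite -[a \in _]/(asbool _); apply: asboolP. Qed.

Lemma gen_subalg_closed : subalg_closed gen_subalg_pred.
Proof.
split=> [|k a b /gen_subalgP Ha /gen_subalgP Hb|a b /gen_subalgP Ha /gen_subalgP Hb];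
  apply/gen_subalgP => S cS SX; case: (cS) => S1 SP SM //.
  by apply: SP; [apply: Ha | apply: Hb].
by apply: SM; [apply: Ha | apply: Hb].
Qed.

HB.instance Definition _ := GRing.isSubalgClosed.Build K A gen_subalg_pred
  (GRing.subalg_closed_semi gen_subalg_closed).

Lemma gen_subalg_gen i : X i \in gen_subalg_pred.
Proof. by apply/gen_subalgP => S _; apply. Qed.

Record gen_subalg := GenSubalg {
  gen_subalg_val :> A;
  gen_subalg_valP : gen_subalg_val \in gen_subalg_pred }.

HB.instance Definition _ := [isSub for gen_subalg_val].
HB.instance Definition _ := [Choice of gen_subalg by <:].
HB.instance Definition _ := [SubChoice_isSubAlgebra of gen_subalg by <:].

Definition gen_subalg_var (i : 'I_n) : gen_subalg :=
  GenSubalg (gen_subalg_gen i).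

Lemma gen_subalg_nceval a :
  a \in gen_subalg_pred <-> exists p : ncpoly K n, nceval X p = a.
Proof.
split=> [/gen_subalgP Ha|[p <-]].
  suff: a \in [pred b | `[< exists p : ncpoly K n, nceval X p = b >]].
    by rewrite inE => /asboolP.
  apply: Ha => [|i]; last by rewrite inE; apply/asboolP; exists (ncvar K i);
    rewrite nceval_var.
  split=> [|k b c|b c]; rewrite !inE.
  - by apply/asboolP; exists 1; rewrite rmorph1.
  - move=> /asboolP[p <-] /asboolP[q <-]; apply/asboolP.
    by exists (k *: p + q); rewrite linearP.
  - move=> /asboolP[p <-] /asboolP[q <-]; apply/asboolP.
    by exists (p * q); rewrite rmorphM.
elim/ncpoly_ind: p => [|k w p IHp]; first by rewrite linear0 rpred0.
rewrite linearP /=; apply: rpredD => //; apply: rpredZ.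
by rewrite nceval_mon; apply: rpred_prod => i _; exact: gen_subalg_gen.
Qed.

End GeneratedSubalgebra.

Record hilbert (R : realType) := Hilbert {
  hilbert_sort :> completeNormedModType R[i];
  inner : {dot hilbert_sort for Num.conj};
  inner_norm : forall v : hilbert_sort, `|v| ^+ 2 = inner v v }.

Section Operators.
Context (R : realType) (H : hilbert R).

Definition bounded_operator (T : H -> H) : Prop := linear T /\ continuous T.

Definition commutant (S : set (H -> H)) : set (H -> H) :=
  [set T | bounded_operator T /\ forall U, S U -> forall v, T (U v) = U (T v)].

End Operators.

(* A von Neumann algebra: a star-algebra of bounded operators on a Hilbert
   space which is equal to its bicommutant. The algebra is presented as a type
   together with its (faithful) identity representation vN_op. *)
Record von_neumann (R : realType) := VonNeumann {
  vN_space : hilbert R;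
  vN_sort :> algType R[i];
  vN_star : vN_sort -> vN_sort;
  vN_op : vN_sort -> vN_space -> vN_space;
  vN_op_inj : injective vN_op;
  vN_op_bounded : forall a, bounded_operator (vN_op a);
  vN_opP : forall k a b v, vN_op (k *: a + b) v = k *: vN_op a v + vN_op b v;
  vN_op1 : forall v, vN_op 1 v = v;
  vN_opM : forall a b v, vN_op (a * b) v = vN_op a (vN_op b v);
  vN_op_star : forall a u v,
    inner vN_space (vN_op a u) v = inner vN_space u (vN_op (vN_star a) v);
  vN_bicommutant : commutant (commutant (range vN_op)) = range vN_op }.

Section VonNeumannTheory.
Context (R : realType) (M : von_neumann R).
Implicit Types (a b d : M) (tau : M -> R[i]).

Definition selfadjoint a : Prop := vN_star a = a.

Definition op_le a b : Prop :=
  forall v, 0 <= inner (vN_space M) (vN_op (b - a) v) v.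

Definition op_sup (D : set M) a : Prop :=
  selfadjoint a /\ (forall d, D d -> op_le d a) /\
  forall b, selfadjoint b -> (forall d, D d -> op_le d b) -> op_le a b.

Definition op_directed (D : set M) : Prop :=
  D !=set0 /\
  forall d d', D d -> D d' -> exists e, [/\ D e, op_le d e & op_le d' e].

Definition positive tau : Prop := forall a, 0 <= tau (vN_star a * a).
Definition tracial tau : Prop := forall a b, tau (a * b) = tau (b * a).
Definition faithful tau : Prop := forall a, tau (vN_star a * a) = 0 -> a = 0.

(* tau (sup D) = sup tau (D) for bounded increasing nets D of self-adjoint
   elements; [<=] on R[i] compares real parts and requires equal imaginary
   parts, so the upper bounds c of tau (D) are real numbers *)
Definition normal tau : Prop :=
  forall (D : set M) a, (forall d, D d -> selfadjoint d) -> op_directed D ->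
    op_sup D a ->
    (forall d, D d -> tau d <= tau a) /\
    (forall c : R[i], (forall d, D d -> tau d <= c) -> tau a <= c).

End VonNeumannTheory.

Record tracial_Wstar (R : realType) := TracialWstar {
  tW_alg :> von_neumann R;
  tW_tau : {scalar tW_alg};
  tW_unital : tW_tau 1 = 1;
  tW_positive : positive tW_tau;
  tW_tracial : tracial tW_tau;
  tW_faithful : faithful tW_tau;
  tW_normal : normal tW_tau }.

Arguments tW_tau {R} _.

(* L^2(M, tau): a Hilbert space with a dense isometric copy of
   (M, <a, b> = tau (a b^* )), i.e. a completion, unique up to isomorphism *)
Record L2_completion (R : realType) (M : tracial_Wstar R) := L2Completion {
  L2_space :> hilbert R;
  L2_emb : {linear M -> L2_space};
  L2_inner : forall a b : M,
    inner L2_space (L2_emb a) (L2_emb b) = tW_tau M (a * vN_star b);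
  L2_dense : dense (range L2_emb) }.

Section ConjugateRelations.
Context (R : realType) (M : tracial_Wstar R) (L2 : L2_completion M).

(* tau (xi a) for xi in L^2(M, tau) and a in M *)
Definition L2_tau (xi : L2) (a : M) : R[i] :=
  inner L2 xi (L2_emb L2 (vN_star a)).

Definition conjugate_relations (n : nat) (X : 'I_n -> M) (xi : 'I_n -> L2) :=
  forall (j : 'I_n) (P : ncpoly R[i] n),
    tform (tW_tau M) (tW_tau M) (tmap (nceval X) (nceval X) (fdq j P)) =
    L2_tau (xi j) (nceval X P).

End ConjugateRelations.

(* Main.v *)
(* If P(X) = 0, the conjugate relation for P Q gives
   tau (((tau (x) id) (d_j P)(X)) Q(X)) = 0 for every Q. Since the X_i are
   self-adjoint, Q(X) can be chosen as the adjoint of the left factor, so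
   faithfulness of tau shows that the polynomial (tau o ev_X (x) id) (d_j P), of
   lower degree, again vanishes at X. Its coefficient at a word w of top length
   is that of Z_j w in P, and descent on the degree gives (a). By (a), ev_X is
   an isomorphism onto C<X_1, ..., X_n>, along which d_j is transported for (b). *)
Require Import Defs.
From HB Require Import structures.
From mathcomp Require Import all_boot all_order all_algebra.
From mathcomp Require Import all_classical all_reals topology normedtype.
From mathcomp Require Import complex finmap zify.
From mathcomp Require Import -(notations) monalg.

Set Implicit Arguments.
Unset Strict Implicit.
Unset Printing Implicit Defensive.

Import GRing.Theory Num.Theory.
Import numFieldNormedType.Exports.

Local Open Scope ring_scope.

(** * Slice maps on tensor products *)

Section LeftSlice.
Context {K : comNzRingType} {A B : lmodType K} (f : {scalar A}).

(** Induces the slice map [f] (x) id, with K (x) B identified with B. *)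
Definition lslice_fun (a : A) (b : B) : B := f a *: b.

Lemma lslice_fun_is_bilinear : bilinear_for *:%R *:%R lslice_fun.
Proof.
split=> [b k a a' | a k b b']; rewrite /lslice_fun.
  by rewrite linearP scalerDl -scalerA.
by rewrite scalerDr /= !scalerA [f a * k]mulrC.
Qed.

HB.instance Definition _ := bilinear_isBilinear.Build K A B B
  *:%R *:%R lslice_fun lslice_fun_is_bilinear.

Definition lslice : tensor A B -> B := tlift lslice_fun.
HB.instance Definition _ := GRing.Linear.on lslice.

Lemma lsliceE a b : lslice (a \ox b) = f a *: b.
Proof. exact: tliftE. Qed.

Lemma lsliceP k t u : lslice (k *: t + u) = k *: lslice t + lslice u.
Proof. exact: linearP. Qed.

End LeftSlice.

(** The form [f] (x) [g] is [g] after [f] (x) id, and slicing the left leg commutes with right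
    multiplication on the other leg. *)
Lemma tform_lslice (K : comNzRingType) (A B : algType K) (f : {scalar A})
    (g : {scalar B}) (t : tensor A B) (b : B) :
  tform f g (t * (1 \ox b)) = g (lslice f t * b).
Proof.
elim/(@tensor_ind K A B): t => [|k x y t IH].
  by rewrite mul0r !linear0 mul0r linear0.
rewrite mulrDl -tensor_scaleAl linearP /= IH tensM mulr1 tformE lsliceP lsliceE.
by rewrite mulrDl -!scalerAl linearP linearZ.
Qed.

(** Lets the slice be taken among polynomials, before evaluation, where word lengths are
    available. *)
Lemma lslice_tmap (K : comNzRingType) (A A' B B' : lmodType K)
    (u : {linear A -> A'}) (v : {linear B -> B'}) (f : {scalar A})
    (f' : {scalar A'}) (t : tensor A B) :
  f' \o u =1 f -> lslice f' (tmap u v t) = v (lslice f t).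
Proof.
move=> fE; elim/(@tensor_ind K A B): t => [|k a b t IH].
  by rewrite !linear0.
by rewrite tmapP !lsliceP IH linearP tmapE !lsliceE -fE [v (_ *: _)]linearZ.
Qed.

Lemma tmapD (K : comNzRingType) (A A' B B' : lmodType K)
    (u : {linear A -> A'}) (v : {linear B -> B'}) (s t : tensor A B) :
  tmap u v (s + t) = tmap u v s + tmap u v t.
Proof. exact: raddfD. Qed.

Section TensorMapAlgebra.
Context {K : comNzRingType} {A A' B B' : algType K}.
Context (u : {lrmorphism A -> A'}) (v : {lrmorphism B -> B'}).

Lemma tmapM (s t : tensor A B) : tmap u v (s * t) = tmap u v s * tmap u v t.
Proof.
elim/(@tensor_ind K A B): s => [|k a b s IHs]; first by rewrite mul0r !tmap0 mul0r.
rewrite mulrDl -tensor_scaleAl !tmapP IHs [RHS]mulrDl -tensor_scaleAl.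
congr (k *: _ + _); clear k s IHs.
elim/(@tensor_ind K A B): t => [|k c d t IHt]; first by rewrite mulr0 !tmap0 mulr0.
rewrite mulrDr -tensor_scaleAr !tmapP IHt [RHS]mulrDr -tensor_scaleAr.
by rewrite tensM !tmapE tensM !rmorphM.
Qed.

End TensorMapAlgebra.

(** * Top coefficients of sliced difference quotients *)

Section LeftSliceFdq.
Context (K : comNzRingType) (n : nat) (j : 'I_n) (f : {scalar ncpoly K n}).
Hypothesis f1 : f 1 = 1.

(** A factorization [u = w1 Z_j w2] with nonempty [w1] leaves [w2] shorter than [w], so only the
    empty prefix can contribute, with weight [f 1 = 1]. *)
Lemma mcoeff_lslice_fdq_mon (u w : seq 'I_n) : (size u <= (size w).+1)%N ->
  mcoeff (FMonom w) (lslice f (fdq j (ncmon K u))) = (u == j :: w)%:R.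
Proof.
move=> le_uw; rewrite fdq_mon /fdq_word !raddf_sum /=.
case: u le_uw => [|i u] le_uw; first by rewrite big_ord0.
rewrite big_mkcond big_ord_recl /= big1 => [|k _].
  rewrite addr0 drop0 eqseq_cons (inj_eq (@Some_inj _)); case: eqP => //= _.
  by rewrite lsliceE ncmon1 f1 scale1r mcoeffU.
case: ifP => // _; rewrite lsliceE mcoeffZ mcoeffU.
case: eqP => [[e]|]; last by rewrite mulr0.
have lt_ku : (k < size u)%N := ltn_ord k.
by exfalso; move: le_uw; rewrite -e size_drop /bump /=; lia.
Qed.

Lemma mcoeff_lslice_fdq (p : ncpoly K n) (w : seq 'I_n) :
  (forall u, ((size w).+1 < size u)%N -> mcoeff (FMonom u) p = 0) ->
  mcoeff (FMonom w) (lslice f (fdq j p)) = mcoeff (FMonom (j :: w)) p.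
Proof.
pose D : {linear ncpoly K n -> ncpoly K n} := lslice f \o fdq j.
move=> p_w; rewrite -[lslice f _]/(D p) [p]malg_mcoeffE !raddf_sum.
apply: eq_bigr => -[u] _; rewrite /= -[lslice f _]/(D _) (linearZZ D) !mcoeffZ.
have [/mcoeff_lslice_fdq_mon e|/p_w ->] := leqP (size u) (size w).+1; last first.
  by rewrite !mul0r.
by congr (_ * _); rewrite [LHS]e mcoeffU.
Qed.

End LeftSliceFdq.

(** * Uniqueness and transport of derivations *)

(** Linearity reduces the claim to words, and the Leibniz rule reduces words to letters; at [1 * 1]
    it forces the value 0 on the empty word. *)
Lemma derivation_eq_on_gens (K : comNzRingType) (n : nat) (A : algType K)
    (X : 'I_n -> A) (d d' : A -> tensor A A) :
  (forall a, exists p, nceval X p = a) -> is_derivation d -> is_derivation d' ->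
  (forall i, d (X i) = d' (X i)) -> d =1 d'.
Proof.
move=> surj [dL dM] [d'L d'M] dX a; have [p <-] := surj a.
have linear_at0 (e : A -> tensor A A) : linear e -> e 0 = 0.
  by move=> eL; have := eL (-1) 0 0; rewrite scaler0 addr0 scaleN1r addNr.
elim/ncpoly_ind: p => [|k w p IHp].
  by rewrite linear0 (linear_at0 _ dL) (linear_at0 _ d'L).
rewrite linearP dL d'L IHp; congr (k *: _ + _); clear p IHp.
elim: w => [|i w IHw].
  by rewrite ncmon1 rmorph1 (derivation1 (dM 1 1)) (derivation1 (d'M 1 1)).
by rewrite -cat1s -ncmonM rmorphM dM d'M IHw /= nceval_mon big_seq1 dX.
Qed.

(** The inverse [v] is a bare function; injectivity of [u] makes it linear and multiplicative. *)
Lemma derivation_transport (K : comNzRingType) (A B : algType K)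
    (u : {lrmorphism A -> B}) (v : B -> A) (d : A -> tensor A A) :
  cancel u v -> cancel v u -> is_derivation d ->
  is_derivation (tmap u u \o d \o v).
Proof.
move=> uK vK [dL dM]; split=> [k a b|a b] /=.
  have -> : v (k *: a + b) = k *: v a + v b.
    by apply: (can_inj uK); rewrite vK linearP /= !vK.
  by rewrite dL tmapP.
have -> : v (a * b) = v a * v b.
  by apply: (can_inj uK); rewrite vK rmorphM /= !vK.
by rewrite dM tmapD !tmapM !tmapE /= !vK rmorph1.
Qed.

Lemma unique_derivation_of_alg_free (K : comNzRingType) (n : nat) (A : algType K)
    (X : 'I_n -> A) (j : 'I_n) :
  (forall p, nceval X p = 0 -> p = 0) -> (forall a, exists p, nceval X p = a) ->
  exists! d : A -> tensor A A,
    is_derivation d /\ forall i, d (X i) = (j == i)%:R *: (1 \ox 1).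
Proof.
move=> free surj; pose v a := projT1 (cid (surj a)).
have vK : cancel v (nceval X) by move=> a; rewrite /v; case: cid.
have uK : cancel (nceval X) v.
  by move=> p; apply/subr0_eq/free; rewrite linearB /= vK subrr.
have dd := derivation_transport uK vK (fdq_is_derivation K j).
have dX i : (tmap (nceval X) (nceval X) \o fdq j \o v) (X i) =
    (j == i)%:R *: (1 \ox 1).
  rewrite /= -{1}(nceval_var X i) uK fdq_var.
  (* The added 0 gives the shape [k *: t + u] that [tmapP] expects. *)
  rewrite -[_ *: _]addr0 tmapP tmap0 addr0.
  by rewrite tmapE rmorph1.
exists (tmap (nceval X) (nceval X) \o fdq j \o v); split=> // d' [d'd d'X].
apply/funext; apply: (derivation_eq_on_gens surj dd d'd) => i.
by rewrite d'X dX.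
Qed.

(** * Descent on word length *)

Section AlgebraicFreeness.
Context (K : comNzRingType) (n : nat) (A : algType K) (X : 'I_n -> A).
Context (tau : {scalar A}).
Hypothesis tau1 : tau 1 = 1.

Definition tau_nceval (p : ncpoly K n) : K := tau (nceval X p).

Lemma tau_nceval_is_scalar : scalar tau_nceval.
Proof. by move=> k p q; rewrite /tau_nceval !linearP. Qed.

HB.instance Definition _ :=
  GRing.isLinear.Build K (ncpoly K n) K _ tau_nceval tau_nceval_is_scalar.

Hypothesis slice_ker : forall j p, nceval X p = 0 ->
  nceval X (lslice tau_nceval (fdq j p)) = 0.

Lemma alg_free_of_slice_ker p : nceval X p = 0 -> p = 0.
Proof.
have t1 : tau_nceval 1 = 1 by rewrite /tau_nceval rmorph1.
(* [d] strictly bounds the word lengths of [q]; [q] is arbitrary because the induction is applied to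
   its slices. *)
suff H d q : (forall u, (d <= size u)%N -> mcoeff (FMonom u) q = 0) ->
    nceval X q = 0 -> q = 0.
  apply: (H (\max_(u <- msupp p) size (fmonom_val u)).+1) => u.
  have [u_p|u_p _] := boolP (FMonom u \in msupp p); last exact: mcoeff_outdom.
  by rewrite ltnNge (leq_bigmax_seq (F := fun x => size (fmonom_val x)) _ u_p).
elim: d q => [|d IHd] q q_d q0.
  by apply/malgP => -[u]; rewrite q_d // mcoeff0.
(* Only words of length exactly [d] remain to be excluded. *)
apply: (IHd q _ q0) => u; rewrite leq_eqVlt => /orP[/eqP|]; last exact: q_d.
case: u => [|j w] d_u.
  (* Here [d] is 0, so [q] is a constant, which [tau 1 = 1] detects. *)
  have qE : q = (mcoeff (FMonom [::]) q) *: 1.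
    apply/malgP => -[u]; rewrite mcoeffZ -(ncmon1 K n) mcoeffU.
    have [[<-]|u0] := eqVneq (FMonom [::]) (FMonom u); first by rewrite mulr1.
    rewrite mulr0 q_d // d_u lt0n size_eq0.
    by apply: contraNneq u0 => ->.
  set c := mcoeff _ q in qE *; have := congr1 tau q0.
  by rewrite qE linear0 !linearZ rmorph1 /= tau1 mulr1.
(* Used at [w], where the bound is an equality, and at words of length at least [d], to see that the
   slice has only words shorter than [d]. *)
have cE w' : (d <= (size w').+1)%N ->
    mcoeff (FMonom w') (lslice tau_nceval (fdq j q)) =
    mcoeff (FMonom (j :: w')) q.
  move=> le_dw; apply: mcoeff_lslice_fdq => // u lt_u.
  by apply: q_d; apply: leq_ltn_trans lt_u.
rewrite -cE ?d_u // (IHd (lslice tau_nceval (fdq j q))) ?mcoeff0 //.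
  by move=> u le_du; rewrite cE ?q_d // leqW.
exact: slice_ker.
Qed.

End AlgebraicFreeness.

(** * Adjoints in a von Neumann algebra *)

Section Star.
Context (R : realType) (M : von_neumann R).
Implicit Types a b : M.

Lemma inner_eq (H : hilbert R) (v w : H) :
  (forall u, inner H u v = inner H u w) -> v = w.
Proof.
move=> vw; apply/subr0_eq/eqP; rewrite -normr_eq0 -sqrf_eq0 inner_norm.
by rewrite linearBr /= vw subrr.
Qed.

(** Adjoints are unique and [vN_op] is injective; the laws of the involution below all follow from
    this. *)
Lemma vN_star_eq a b :
  (forall u v, inner _ (vN_op a u) v = inner _ u (vN_op b v)) -> vN_star a = b.
Proof.
move=> ab; apply/vN_op_inj/funext => v; apply: inner_eq => u.
by rewrite -vN_op_star ab.
Qed.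

Lemma vN_starP k a b : vN_star (k *: a + b) = k^* *: vN_star a + vN_star b.
Proof.
apply: vN_star_eq => u v; rewrite !vN_opP linearPl linearPr /=.
by rewrite !vN_op_star conjCK.
Qed.

Lemma vN_starM a b : vN_star (a * b) = vN_star b * vN_star a.
Proof. by apply: vN_star_eq => u v; rewrite !vN_opM !vN_op_star. Qed.

Lemma vN_star1 : vN_star (1 : M) = 1.
Proof. by apply: vN_star_eq => u v; rewrite !vN_op1. Qed.

Lemma vN_star0 : vN_star (0 : M) = 0.
Proof.
by have := vN_starP (-1) 0 0; rewrite scaler0 addr0 rmorphN1 scaleN1r addNr.
Qed.

(** Reversing words and conjugating coefficients gives [q]. *)
Lemma vN_star_nceval n (X : 'I_n -> M) (p : ncpoly R[i] n) :
  (forall i, selfadjoint (X i)) ->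
  exists q : ncpoly R[i] n, nceval X q = vN_star (nceval X p).
Proof.
move=> X_sa; elim/ncpoly_ind: p => [|k w p [q qE]].
  by exists 0; rewrite !linear0 vN_star0.
suff [r rE] : exists r : ncpoly R[i] n,
    nceval X r = vN_star (nceval X (ncmon _ w)).
  by exists (k^* *: r + q); rewrite !linearP vN_starP /= rE qE.
elim: w {p q qE} => [|i w [r rE]].
  by exists 1; rewrite ncmon1 !rmorph1 vN_star1.
exists (r * ncvar _ i).
by rewrite -cat1s -ncmonM !rmorphM vN_starM /= rE nceval_var X_sa.
Qed.

End Star.

(** * Kernel of evaluation under the conjugate relations *)

Section ConjugateVariables.
Context (R : realType) (M : tracial_Wstar R) (L2 : L2_completion M).
Context (n : nat) (X : 'I_n -> M) (xi : 'I_n -> L2).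
Hypothesis X_selfadjoint : forall i, selfadjoint (X i).
Hypothesis X_xi : conjugate_relations X xi.

Local Notation tauX := (tau_nceval X (tW_tau M)).

(* The conjugate relation for p * q: as p(X) = 0, its right-hand side and the
   Leibniz term containing p \ox 1 both vanish. *)
Lemma tau_slice_fdq_mul j p q : nceval X p = 0 ->
  tW_tau M (nceval X (lslice tauX (fdq j p)) * nceval X q) = 0.
Proof.
move=> p0; have := X_xi j (p * q).
rewrite rmorphM /= p0 mul0r /L2_tau vN_star0 linear0 linear0r.
set t := fdq j p => <-.
rewrite fdqM -/t tmapD !tmapM !tmapE /= p0 linear0l mul0r addr0 rmorph1.
by rewrite tform_lslice (@lslice_tmap _ _ _ _ _ _ _ tauX).
Qed.

Lemma slice_fdq_ker j p : nceval X p = 0 -> nceval X (lslice tauX (fdq j p)) = 0.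
Proof.
move=> p0.
have [q qE] := vN_star_nceval (lslice tauX (fdq j p)) X_selfadjoint.
(* Traciality moves the adjoint to the right, where it is the free factor [nceval X q]. *)
by apply: tW_faithful; rewrite tW_tracial -qE; apply: tau_slice_fdq_mul.
Qed.

Lemma conjugate_alg_free p : nceval X p = 0 -> p = 0.
Proof. exact: (alg_free_of_slice_ker (tW_unital M) slice_fdq_ker). Qed.

End ConjugateVariables.

Theorem theorem2p7 (R : realType) (M : tracial_Wstar R) (L2 : L2_completion M)
    (n : nat) (X : 'I_n -> M) (X_selfadjoint : forall i, selfadjoint (X i))
    (xi : 'I_n -> L2) (X_xi : conjugate_relations X xi) :
  (~ exists P : ncpoly R[i] n, P <> 0 /\ nceval X P = 0) /\
  (forall j : 'I_n,
     exists! d : gen_subalg X -> tensor (gen_subalg X) (gen_subalg X),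
       is_derivation d /\
       forall i : 'I_n, d (gen_subalg_var X i) = (j == i)%:R *: (1 \ox 1)).
Proof.
have free := conjugate_alg_free X_selfadjoint X_xi.
split=> [[P [P_neq0 /free]]|j] //.
(* Evaluation in the subalgebra agrees with evaluation in [M], so freeness and surjectivity pass to
   [gen_subalg X]. *)
have valE p : gen_subalg_val (nceval (gen_subalg_var X) p) = nceval X p.
  elim/ncpoly_ind: p => [|k w p IHp]; first by rewrite !linear0.
  rewrite !linearP /= -IHp !nceval_mon.
  congr (_ *: _ + _); exact: (rmorph_prod (val : gen_subalg X -> M)).
apply: unique_derivation_of_alg_free => [p p0|[a a_X]].
  by apply: free; rewrite -valE p0.
have [p pE] := (gen_subalg_nceval X a).1 a_X.
by exists p; apply: val_inj; rewrite /= valE.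
Qed.
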